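(* Let $[B]\sqsubseteq[A]$, that is, $\operatorname{Row}(A)\subseteq\operatorname{Row}(B)$, with $A=TB$ for a real matrix $T$, and let $f\in\mathbb{C}^A$. Then inclusion of subsets of $\mathbb{R}^{1+n}$ gives an injective map $$\pi_0\big(\mathbb{R}^{1+n}\setminus\mathcal{A}_B(f)\big)\to\pi_0\big(\mathbb{R}^{1+n}\setminus\mathcal{A}(f)\big),$$ sending a connected component of the complement of $\mathcal{A}_B(f)$ to the connected component of the complement of $\mathcal{A}(f)$ containing it.
   Context: $A\subset\mathbb{R}^{1+n}$ is a finite set of cardinality $N$; its elements $\alpha(1),\dots,\alpha(N)$ are arranged as the columns of a $(1+n)\times N$ matrix, also denoted $A$. It is assumed that $A$ is pseudo-homogeneous: there is a linear form $\xi$ with $\langle\xi,\alpha\rangle=1$ for all $\alpha\in A$, i.e. $\mathbf{1}=(1,\dots,1)$ lies in the real row span $\operatorname{Row}(A)$. $\mathbb{C}^A$ is the space of exponential sums $f(\mathbf{z})=\sum_{j=1}^N c_j e^{\langle\mathbf{z},\alpha(j)\rangle}$, $c_j\in\mathbb{C}$, in $\mathbf{z}\in\mathbb{C}^{1+n}$. The amoeba of $f$ is $\mathcal{A}(f)=\overline{\operatorname{Re}(V(f))}\subset\mathbb{R}^{1+n}$, where $V(f)\subset\mathbb{C}^{1+n}$ is the zero set of $f$; the same definitions are used for other supports. $B$ is a real $(1+m)\times N$ matrix with columns $\beta(1),\dots,\beta(N)$, also pseudo-homogeneous, and $A=TB$ with $T$ a real $(1+n)\times(1+m)$ matrix. The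 isomorphism $\Phi\colon\mathbb{C}^A\to\mathbb{C}^B$ sends $\sum_j c_j e^{\langle\mathbf{z},\alpha(j)\rangle}$ to $\sum_j c_j e^{\langle\mathbf{y},\beta(j)\rangle}$ ($\mathbf{y}\in\mathbb{C}^{1+m}$). The map $\iota\colon\mathbb{R}^{1+n}\to\mathbb{R}^{1+m}$ is $\mathbf{x}\mapsto\mathbf{x}T$ (row vectors), with image $H_T$. The large $B$-caisson is $\mathcal{L}_B(f)=\mathcal{A}(\Phi f)\subset\mathbb{R}^{1+m}$. The small $B$-caisson $\mathcal{A}_B(f)$ is $\mathcal{L}_B(f)\cap H_T$, considered as a subset of $\mathbb{R}^{1+n}$ via its inverse image under $\iota$, i.e. $\mathcal{A}_B(f)=\iota^{-1}(\mathcal{L}_B(f))$. It is known that $\mathcal{A}(f)\subset\mathcal{A}_B(f)$, so the map on connected components is well defined. $\pi_0$ denotes the set of connected components. *)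

(* Defs.v *)
From HB Require Import structures.
From mathcomp Require Import all_boot all_order all_algebra.
From mathcomp Require Import all_classical all_reals all_analysis.
From mathcomp Require Export complex.

Set Implicit Arguments.
Unset Strict Implicit.
Unset Printing Implicit Defensive.

Import Order.TTheory GRing.Theory Num.Theory.
Import numFieldNormedType.Exports.

Local Open Scope classical_set_scope.
Local Open Scope ring_scope.
Local Open Scope complex_scope.

(* Points of R^d and C^d are row vectors; a support with N elements is the
   family of columns of a d x N real matrix. *)

Definition expC (R : realType) (z : R[i]) : R[i] :=
  (expR (complex.Re z))%:C * (cos (complex.Im z) +i* sin (complex.Im z)).

(* <z, alpha(j)>, bilinear (no conjugation) *)
Definition pairing (R : realType) (d N : nat) (A : 'M[R]_(d, N))
    (z : 'rV[R[i]]_d) (j : 'I_N) : R[i] :=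
  \sum_(k < d) z 0 k * (A k j)%:C.

Definition expsum (R : realType) (d N : nat) (A : 'M[R]_(d, N))
    (c : 'rV[R[i]]_N) : 'rV[R[i]]_d -> R[i] :=
  fun z => \sum_(j < N) c 0 j * expC (pairing A z j).

Definition exp_space (R : realType) (d N : nat) (A : 'M[R]_(d, N)) :
    set ('rV[R[i]]_d -> R[i]) :=
  range (expsum A).

Definition pseudo_homogeneous (R : realType) (d N : nat) (A : 'M[R]_(d, N)) :=
  exists xi : 'rV[R]_d, xi *m A = const_mx 1.

Definition amoeba (R : realType) (d : nat) (f : 'rV[R[i]]_d -> R[i]) :
    set 'rV[R]_d :=
  closure (map_mx (@complex.Re R) @` [set z | f z = 0]).

(* The coefficients of an element of [exp_space A] are unique when the columns
   of A are distinct, see [Phi_expsum] below; [xget] selects them. *)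
Definition Phi (R : realType) (d e N : nat) (A : 'M[R]_(d, N))
    (B : 'M[R]_(e, N)) (f : 'rV[R[i]]_d -> R[i]) : 'rV[R[i]]_e -> R[i] :=
  expsum B (xget 0 [set c | f = expsum A c]).

Definition large_caisson (R : realType) (d e N : nat) (A : 'M[R]_(d, N))
    (B : 'M[R]_(e, N)) (f : 'rV[R[i]]_d -> R[i]) : set 'rV[R]_e :=
  amoeba (Phi A B f).

(* H_T is the image of x |-> x T, so the preimage of [large_caisson] is also that
   of its intersection with H_T. *)
Definition small_caisson (R : realType) (d e N : nat) (A : 'M[R]_(d, N))
    (B : 'M[R]_(e, N)) (T : 'M[R]_(d, e)) (f : 'rV[R[i]]_d -> R[i]) :
    set 'rV[R]_d :=
  (fun x => x *m T) @^-1` large_caisson A B f.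

Definition pi0 (X : topologicalType) (S : set X) : set (set X) :=
  connected_component S @` S.

Lemma expC_real_natmul (R : realType) (s : R) (k : nat) :
  expC (k%:R * s)%:C = (expR s)%:C ^+ k.
Proof.
rewrite /expC /= cos0 sin0 mulr1 -rmorphXn /= -expRM_natl.
by [].
Qed.

Lemma ex_separating (R : realType) (d N : nat) (A : 'M[R]_(d, N)) :
  injective (fun j : 'I_N => col j A) -> exists v : 'rV[R]_d, injective (fun j => (v *m A) 0 j).
Proof.
move=> injA.
pose q (p : 'I_N * 'I_N) : {poly R} := \poly_(k < d)
  (if insub k is Some k' then A k' p.1 - A k' p.2 else 0).
pose Q := \prod_(p : 'I_N * 'I_N | p.1 != p.2) q p.
have Q0 : Q != 0.
  apply/prodf_neq0 => -[a b] /= ab; apply/negP => /eqP q0.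
  move/eqP: ab; apply; apply: injA; apply/colP => k; rewrite !mxE.
  have := congr1 (fun p : {poly R} => p`_k) q0.
  rewrite coef_poly ltn_ord coef0 insubT ?ltn_ord//= => h hk.
  have /eqP := hk; rewrite subr_eq0 => /eqP; congr (A _ _ = A _ _); exact: val_inj.
have [t Qt] : exists t : R, ~~ root Q t.
  apply: contrapT => /forallNP Qr.
  have := @max_poly_roots _ Q [seq i%:R | i <- iota 0 (size Q)] Q0.
  rewrite size_map size_iota ltnn => /(_ _ _)/negP; apply => //.
    by apply/allP => x _; apply: contrapT => /negP; exact: Qr.
  by rewrite map_inj_uniq ?iota_uniq// => x y /eqP; rewrite eqr_nat => /eqP.
exists (\row_k t ^+ k) => a b; rewrite !mxE => E.
apply/eqP; apply: contraNT Qt => ab.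
rewrite /root horner_prod (bigD1 (a, b))//= mulf_eq0; apply/orP; left.
rewrite horner_poly; apply/eqP; rewrite -[RHS](subrr (\sum_j (\row_k t ^+ k) 0 j * A j a)).
rewrite [in X in _ = _ - X]E -sumrB; apply: eq_bigr => k _.
rewrite insubT ?ltn_ord//= => hk; rewrite !mxE.
have -> : Sub (k : nat) hk = k by exact: val_inj.
by rewrite mulrC mulrBr.
Qed.

Lemma expsum_inj (R : realType) (d N : nat) (A : 'M[R]_(d, N)) :
  injective (fun j : 'I_N => col j A) -> injective (expsum A).
Proof.
move=> /ex_separating[v injv] c c' E.
pose a : 'rV[R[i]]_N := \row_j (expR ((v *m A) 0 j))%:C.
have V : Vandermonde N a \in unitmx.
  rewrite unitmxE det_Vandermonde unitfE.
  apply/prodf_neq0 => i _; apply/prodf_neq0 => j ij.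
  rewrite !mxE subr_eq0; apply/negP => /eqP[] /expR_inj E'; have ji : j = i by apply: injv; rewrite !mxE.
  by rewrite ji ltnn in ij.
have P k j : pairing A (\row_l (k%:R * v 0 l)%:C) j = (k%:R * (v *m A) 0 j)%:C.
  rewrite /pairing mxE mulr_sumr rmorph_sum; apply: eq_bigr => l _.
  by rewrite mxE -rmorphM mulrA.
have : (Vandermonde N a) *m (c - c')^T = 0.
  rewrite linearB/= mulmxBr; apply/eqP; rewrite subr_eq0; apply/eqP/colP => k.
  have := congr1 (@^~ (\row_l ((k : nat)%:R * v 0 l)%:C)) E.
  rewrite /expsum /= => Ek; rewrite !mxE.
  transitivity (\sum_j c 0 j * expC (pairing A (\row_l ((k : nat)%:R * v 0 l)%:C) j)).
    by apply: eq_bigr => j _; rewrite P expC_real_natmul !mxE mulrC.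
  by rewrite Ek; apply: eq_bigr => j _; rewrite P expC_real_natmul !mxE mulrC.
move=> /(congr1 (mulmx (invmx (Vandermonde N a)))).
rewrite mulKmx// mulmx0 => /(congr1 trmx); rewrite trmxK trmx0 => /eqP.
by rewrite subr_eq0 => /eqP.
Qed.

Lemma Phi_expsum (R : realType) (d e N : nat) (A : 'M[R]_(d, N))
    (B : 'M[R]_(e, N)) (c : 'rV[R[i]]_N) :
  injective (fun j : 'I_N => col j A) -> Phi A B (expsum A c) = expsum B c.
Proof.
move=> injA; rewrite /Phi; congr expsum; case: xgetP => [c' -> /= |/(_ c)].
  by move/(expsum_inj injA).
by move=> /(_ erefl).
Qed.

(* Main.v *)
(** An exponential sum [f] with frequencies the columns of [A] and coefficients
    [c] is replaced by all limits of its imaginary translates: these have the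
    coefficients [c w], with [w] in the compact torus [torus A], the closure of
    the phases [exp (i y A)].  A point [x] lies outside the amoeba iff no such
    limit vanishes at [x].

    If no limit of [f] vanishes at [x0] or at [p], then the minimum [m] of
    [|sum c w exp]| over the torus and the segment [[x0, p]] is either zero or at
    least the minimum over the two end points, by the minimum modulus principle
    in the strip spanned by [x0] and [p].  As [m] depends continuously on
    [(c, p)], nonvanishing on the segment is open and closed in any connected
    family of pairs [(c, p)] without zeros at the end points.  Moving [p] through
    a component of the complement of the amoeba of [f] shows that [f] has no
    zeros above a segment [[x0, x1]] with end points in this component.  If in
    addition [x0] and [x1] lie outside the small caisson, then moving [c] through
    [c w] with [w] in the connected group [torus B] shows that the segment avoids
    the small caisson. *)
Require Import Defs.
From mathcomp Require Import all_boot all_order all_algebra.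
From mathcomp Require Import all_classical all_reals all_analysis.
From mathcomp Require Import ring lra.

Set Implicit Arguments.
Unset Strict Implicit.
Unset Printing Implicit Defensive.

Import Order.TTheory GRing.Theory Num.Theory.
Import numFieldNormedType.Exports.
Import Normc.

Local Open Scope classical_set_scope.
Local Open Scope ring_scope.
Local Open Scope complex_scope.

(** * Taylor expansion of the complex exponential *)

Section ComplexExponential.
Variable R : realType.
Implicit Types (z w u : R[i]) (t : R) (p : nat).

Lemma normc_ge0 z : 0 <= normc z.
Proof. by case: z => a b; exact: sqrtr_ge0. Qed.

Lemma normc_eq0 z : (normc z == 0) = (z == 0).
Proof. by apply/eqP/eqP => [/eq0_normc//|->]; rewrite normc0. Qed.

Lemma normc_gt0 z : (0 < normc z) = (z != 0).
Proof. by rewrite lt_def normc_eq0 normc_ge0 andbT. Qed.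

Lemma normcD_le z w : normc (z + w) <= normc z + normc w.
Proof. exact: le_normcD. Qed.

Lemma normcX z p : normc (z ^+ p) = normc z ^+ p.
Proof. by elim: p => [|p IH]; rewrite ?expr0 ?normc1// !exprS normcM IH. Qed.

Lemma normc_real t : normc t%:C = `|t|.
Proof. by rewrite /= expr0n addr0 sqrtr_sqr. Qed.

Lemma normc_sum (I : Type) (r : seq I) (P : pred I) (F : I -> R[i]) :
  normc (\sum_(i <- r | P i) F i) <= \sum_(i <- r | P i) normc (F i).
Proof.
elim/big_rec2: _ => [|i x y _ le_yx]; first by rewrite normc0.
by rewrite (le_trans (normcD_le _ _))// lerD2l.
Qed.

Lemma normc_ge_absRe z : `|complex.Re z| <= normc z.
Proof.
case: z => a b /=; rewrite -sqrtr_sqr ler_sqrt ?addr_ge0 ?sqr_ge0//.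
by rewrite lerDl sqr_ge0.
Qed.

Lemma normc_ge_absIm z : `|complex.Im z| <= normc z.
Proof.
case: z => a b /=; rewrite -sqrtr_sqr ler_sqrt ?addr_ge0 ?sqr_ge0//.
by rewrite lerDr sqr_ge0.
Qed.

Lemma normc_le_ReIm z : normc z <= `|complex.Re z| + `|complex.Im z|.
Proof.
case: z => a b; rewrite /= -[leRHS]ger0_norm ?addr_ge0// -sqrtr_sqr.
rewrite ler_sqrt ?sqr_ge0// sqrrD !real_normK ?num_real// -addrA [leRHS]addrA addrAC lerDl.
by rewrite mulrn_wge0// mulr_ge0.
Qed.

Lemma expCD z w : expC (z + w) = expC z * expC w.
Proof.
case: z w => a b [c d]; rewrite /expC /= expRD cosD sinD.
by apply/eqP; rewrite eq_complex/=; apply/andP; split; apply/eqP; ring.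
Qed.

Lemma expC0 : expC (0 : R[i]) = 1.
Proof.
rewrite /expC /= expR0 cos0 sin0.
by apply/eqP; rewrite eq_complex/= !(mul0r,mulr0,mulr1,subr0,addr0) !eqxx.
Qed.

Lemma normc_expC z : normc (expC z) = expR (complex.Re z).
Proof.
case: z => a b; rewrite /expC normcM normc_real ger0_norm ?expR_ge0//=.
by rewrite cos2Dsin2 sqrtr1 mulr1.
Qed.

Definition exp_taylor p z := \sum_(k < p) z ^+ k / (k`!)%:R.

(** The mean value theorem needs real functions; the factor [u] lets real parts also stand for
    imaginary parts, through [u = - 'i]. *)
Lemma is_derive_Re_expC u z t :
  is_derive t 1 (fun t => complex.Re (u * expC (t%:C * z)))
    (complex.Re (u * z * expC (t%:C * z))).
Proof.
case: u z => u v [a b].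
have -> : (fun t => complex.Re ((u +i* v) * expC (t%:C * (a +i* b)))) =
   fun t => expR (t * a) * (u * cos (t * b) - v * sin (t * b)).
  by apply/funext => s; rewrite /expC /= !(mul0r, subr0, addr0); ring.
have D c : is_derive t 1 (fun t => t * c) c.
  have -> : (fun t : R => t * c) = c \*: (@id R).
    by apply/funext => s /=; rewrite mulrC.
  by apply: is_derive_eq; rewrite /GRing.scale /= mulr1.
have De : is_derive t 1 (fun t => expR (t * a)) (expR (t * a) * a).
  exact: (@is_derive1_comp _ (@expR R) (fun t => t * a)).
have Dc : is_derive t 1 (fun t => cos (t * b)) (- sin (t * b) * b).
  exact: (@is_derive1_comp _ (@cos R) (fun t => t * b)).
have Ds : is_derive t 1 (fun t => sin (t * b)) (cos (t * b) * b).
  exact: (@is_derive1_comp _ (@sin R) (fun t => t * b)).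
have -> : (fun t => expR (t * a) * (u * cos (t * b) - v * sin (t * b))) =
  (fun t => expR (t * a)) *
  (u \*: (fun t => cos (t * b)) - v \*: (fun t => sin (t * b))) by [].
apply: is_derive_eq; rewrite /GRing.scale /expC /= !(mul0r, subr0, addr0) /GRing.scale /=.
rewrite (_ : (_ - _) t = u * cos (t * b) - v * sin (t * b))//; ring.
Qed.

Lemma is_derive_Re_taylor p u z t :
  is_derive t 1 (fun t => complex.Re (u * exp_taylor p.+1 (t%:C * z)))
    (complex.Re (u * z * exp_taylor p (t%:C * z))).
Proof.
have E v q s : complex.Re (v * exp_taylor q (s%:C * z)) =
    \sum_(k < q) complex.Re (v * (z ^+ k / (k`!)%:R)) * s ^+ k.
  rewrite /exp_taylor mulr_sumr (raddf_sum (@complex.Re R)).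
  apply: eq_bigr => k _.
  transitivity (complex.Re (v * (z ^+ k / (k`!)%:R) * (s ^+ k)%:C)).
    by rewrite rmorphXn exprMn; congr complex.Re; ring.
  by case: (_ * (_ / _)) => x y /=; rewrite mulr0 subr0.
pose c k := complex.Re (u * (z ^+ k / (k`!)%:R)).
have -> : (fun t => complex.Re (u * exp_taylor p.+1 (t%:C * z))) =
   \sum_(k < p.+1) c k \*: (@id R) ^+ k.
  apply/funext => s; rewrite E fct_sumE; apply: eq_bigr => k _.
  by rewrite /= /GRing.scale /= exprfctE.
apply: is_derive_eq.
rewrite E big_ord_recl /= mul0r scale0r scaler0 add0r.
apply: eq_bigr => k _; rewrite /bump /= add1n /GRing.scale /= mulr1.
rewrite add0n [LHS]mulrA; congr (_ * _).
transitivity (complex.Re (u * (z ^+ k.+1 / (k.+1`!)%:R) * (k.+1%:R)%:C)).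
  by rewrite /c; case: (_ * (_ / _)) => x y /=; rewrite mulr0 subr0.
congr complex.Re; rewrite rmorph_nat factS natrM exprS.
have k0 : (k.+1%:R : R[i]) != 0 by rewrite pnatr_eq0.
have f0 : (k`!%:R : R[i]) != 0 by rewrite pnatr_eq0 -lt0n fact_gt0.
by field; rewrite ?f0 ?k0 ?nat1r ?natr1 ?k0.
Qed.

(* In the real variable [t], the derivative of the remainder of order [p.+1] at
   [t z] is [z] times that of order [p]: induction with the mean value theorem,
   applied to real and imaginary parts. *)
Lemma exp_taylor_remainder p z : normc z <= 1 ->
  normc (expC z - exp_taylor p z) <= 2 ^+ p * expR 1 * normc z ^+ p.
Proof.
elim: p z => [|p IH] z z1.
  rewrite /exp_taylor big_ord0 subr0 normc_expC expr0 mul1r mulr1 ler_expR.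
  by rewrite (le_trans _ z1)// (le_trans (ler_norm _)) ?normc_ge_absRe.
have H u : normc u = 1 ->
    `|complex.Re (u * (expC z - exp_taylor p.+1 z))| <=
    2 ^+ p * expR 1 * normc z ^+ p.+1.
  move=> u1.
  pose phi t := complex.Re (u * (expC (t%:C * z) - exp_taylor p.+1 (t%:C * z))).
  pose dphi t := complex.Re (u * z * (expC (t%:C * z) - exp_taylor p (t%:C * z))).
  have D t : is_derive t 1 phi (dphi t).
    have -> : phi = (fun t => complex.Re (u * expC (t%:C * z))) -
       (fun t => complex.Re (u * exp_taylor p.+1 (t%:C * z))).
      by apply/funext => s; rewrite /phi mulrBr (raddfB (@complex.Re R)).
    rewrite /dphi mulrBr (raddfB (@complex.Re R)).
    by apply: is_deriveB; [exact: is_derive_Re_expC|exact: is_derive_Re_taylor].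
  have [|c c01] := @MVT_segment R phi dphi 0 1 ler01 (fun t _ => D t).
    apply: continuous_subspaceT => t; apply: differentiable_continuous.
    by apply/derivable1_diffP; case: (D t).
  have -> : phi 0 = 0.
    rewrite /phi mul0r expC0 /exp_taylor big_ord_recl big1 ?addr0 => [|i _].
      by rewrite expr0 fact0 divr1 subrr mulr0.
    by rewrite expr0n mul0r.
  rewrite !subr0 mulr1 {1}/phi mul1r => ->.
  rewrite (le_trans (normc_ge_absRe _))// !normcM u1 mul1r.
  move: c01; rewrite in_itv /= => /andP[c0 c1].
  have cz : normc (c%:C * z) <= normc z.
    by rewrite normcM normc_real ger0_norm// ler_piMl// normc_ge0.
  rewrite exprS mulrCA ler_wpM2l ?normc_ge0//.
  rewrite (le_trans (IH _ (le_trans cz z1)))// ler_wpM2l ?mulr_ge0 ?exprn_ge0 ?expR_ge0//.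
  by rewrite lerXn2r// nnegrE normc_ge0.
have i1 : normc (- 'i : R[i]) = 1.
  by rewrite /= oppr0 expr0n sqrrN expr1n add0r sqrtr1.
(* Bounding the modulus by the absolute values of real and imaginary part costs a factor 2 at each
   order. *)
rewrite (le_trans (normc_le_ReIm _))// exprS -!mulrA mulr_natl mulr2n lerD//.
  by rewrite mulrA (le_trans _ (H 1 (@normc1 R)))// mul1r.
rewrite mulrA (le_trans _ (H _ i1))//.
set w := _ - _; suff -> : complex.Re (- 'i * w) = complex.Im w by [].
by case: w => x y /=; ring.
Qed.

End ComplexExponential.

(** * Minimum modulus principle for exponential sums in one variable *)

(** Newton interpolation: the value at a new node is corrected by a multiple of the polynomial [Q]
    that vanishes at the earlier nodes. *)
Lemma ex_interpolation (F : fieldType) (s : seq F) (phi : F -> F) :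
  exists P : {poly F}, {in s, forall x, P.[x] = phi x}.
Proof.
elim: s => [|y s [P IH]]; first by exists 0.
have [ys|ys] := boolP (y \in s).
  by exists P => x; rewrite inE => /predU1P[->|]; exact: IH.
pose Q := \prod_(x <- s) ('X - x%:P).
have Q0 x : (Q.[x] == 0) = (x \in s) by exact: root_prod_XsubC.
exists (P + ((phi y - P.[y]) / Q.[y]) *: Q) => x.
rewrite inE hornerD hornerZ => /predU1P[->|xs].
  by rewrite divfK ?Q0// addrC subrK.
by have := Q0 x; rewrite xs => /eqP ->; rewrite mulr0 addr0 IH.
Qed.

Section OneVariableSums.
Variables (R : realType) (N : nat).
Implicit Types (a : 'I_N -> R[i]) (l : 'I_N -> R) (s w : R[i]) (p : nat).

Definition line_sum a l s : R[i] := \sum_j a j * expC (s * (l j)%:C).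

(** This is the [p]-th derivative of [line_sum a l] at 0. *)
Definition moment a l p : R[i] := \sum_j a j * (l j)%:C ^+ p.

Lemma line_sum0 a l : line_sum a l 0 = moment a l 0.
Proof. by apply: eq_bigr => j _; rewrite mul0r expC0 expr0. Qed.

Lemma line_sum_shift a l w s :
  line_sum a l (w + s) = line_sum (fun j => a j * expC (w * (l j)%:C)) l s.
Proof. by apply: eq_bigr => j _; rewrite mulrDl expCD mulrA. Qed.

(** On the finitely many frequencies, [phi] agrees with a polynomial without constant term, so the
    sum is a combination of moments of positive order. *)
Lemma sum_moments_eq0 a l (phi : R[i] -> R[i]) : phi 0 = 0 ->
  (forall p, (0 < p)%N -> moment a l p = 0) -> \sum_j a j * phi (l j)%:C = 0.
Proof.
move=> phi0 M0.
have [P HP] := ex_interpolation (0 :: [seq (l j)%:C | j <- enum 'I_N]) phi.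
rewrite (eq_bigr (fun j => \sum_(k < size P) P`_k * (a j * (l j)%:C ^+ k))); last first.
  move=> j _; rewrite -HP; last first.
    by rewrite inE; apply/orP; right; apply/mapP; exists j; rewrite ?mem_enum.
  rewrite horner_coef mulr_sumr.
  by apply: eq_bigr => k _; rewrite mulrCA.
rewrite exchange_big /= big1// => k _; rewrite -mulr_sumr -/(moment _ _ _).
case: k => -[|k] kP /=; last by rewrite M0 ?mulr0.
by rewrite -horner_coef0 HP ?mem_head// phi0 mul0r.
Qed.

Lemma line_sum_const a l s : (forall p, (0 < p)%N -> moment a l p = 0) ->
  line_sum a l s = line_sum a l 0.
Proof.
move=> M0; apply/eqP; rewrite -subr_eq0 -sumrB; apply/eqP.
rewrite -[RHS](@sum_moments_eq0 a l (fun x => expC (s * x) - 1)) //.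
  by apply: eq_bigr => j _; rewrite mul0r expC0 mulrBr.
by rewrite mulr0 expC0 subrr.
Qed.

(** If all positive moments vanished, testing against the indicator of [l j] would give [a j = 0].
    Subtracting the value of the indicator at 0 is harmless, since the coefficients sum to 0. *)
Lemma ex_moment_neq0 a l j : injective l -> a j != 0 -> moment a l 0 = 0 ->
  exists2 p, (0 < p)%N & moment a l p != 0.
Proof.
move=> injl aj M00; apply: contrapT => noM.
have M0 p : (0 < p)%N -> moment a l p = 0.
  by move=> p0; apply: contrapT => /eqP Mp; apply: noM; exists p.
pose phi (x : R[i]) : R[i] := (x == (l j)%:C)%:R.
have := @sum_moments_eq0 a l (fun x => phi x - phi 0) (subrr _) M0.
under eq_bigr => i _ do rewrite mulrBr.
rewrite sumrB -mulr_suml (_ : \sum_i a i = 0); last first.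
  by rewrite -[RHS]M00; apply: eq_bigr => i _; rewrite expr0 mulr1.
rewrite mul0r subr0 (bigD1 j)//= big1 => [|i ij]; last first.
  rewrite /phi (inj_eq (@complexI R)) (inj_eq injl) (negbTE ij).
  by rewrite mulr0.
by rewrite /phi eqxx mulr1 addr0; apply/eqP.
Qed.

(** Each exponential is expanded to degree [p]; the coefficient of degree [k] is then the [k]-th
    moment over [k!]. *)
Lemma line_sum_expansion a l p : (0 < p)%N ->
  (forall q, (0 < q < p)%N -> moment a l q = 0) ->
  exists C r : R, [/\ 0 < C, 0 < r & forall s, normc s <= r ->
    normc (line_sum a l s - (moment a l 0 + moment a l p / (p`!)%:R * s ^+ p))
      <= C * normc s ^+ p.+1].
Proof.
move=> p0 Mq.
(* [L] bounds all frequencies, so [normc s <= L^-1] keeps every argument in the unit disc, where the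
   remainder estimate holds; the summand 1 makes it invertible. *)
pose L := 1 + \sum_j `|l j|.
have L0 : 0 < L by rewrite ltr_pwDl// sumr_ge0.
have lL j : `|l j| <= L.
  by rewrite /L (bigD1 j)//= addrCA lerDl addr_ge0// sumr_ge0.
pose C := \sum_j normc (a j) * (2 ^+ p.+1 * expR 1 * L ^+ p.+1).
have C0 : 0 <= C.
  apply: sumr_ge0 => j _.
  by rewrite !mulr_ge0 ?normc_ge0 ?exprn_ge0 ?expR_ge0// ltW.
exists (1 + C), L^-1; split; [by rewrite ltr_pwDl|by rewrite invr_gt0|].
move=> s sL.
have -> : moment a l 0 + moment a l p / p`!%:R * s ^+ p =
    \sum_j a j * exp_taylor p.+1 (s * (l j)%:C).
  transitivity (\sum_(k < p.+1) moment a l k * (s ^+ k / k`!%:R)); last first.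
    under eq_bigr => k _ do rewrite mulr_suml.
    rewrite exchange_big /=; apply: eq_bigr => j _; rewrite mulr_sumr.
    by apply: eq_bigr => k _; rewrite exprMn; ring.
  rewrite (bigD1 ord0)//= expr0 fact0 divr1 mulr1; congr (_ + _).
  rewrite (bigD1 ord_max) ?big1 /= ?addr0; first by rewrite mulrAC mulrA.
    move=> i /andP[i0 ip]; rewrite Mq ?mul0r// lt0n i0 /= ltn_neqAle.
    by rewrite ip -ltnS ltn_ord.
  by rewrite -val_eqE /= -lt0n.
rewrite -sumrB (le_trans (normc_sum _ _ _))// mulrDl mul1r.
rewrite (@le_trans _ _ (C * normc s ^+ p.+1))//; last first.
  by rewrite lerDr exprn_ge0// normc_ge0.
rewrite mulr_suml; apply: ler_sum => j _.
rewrite -mulrBr normcM -mulrA ler_wpM2l ?normc_ge0//.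
have sl : normc (s * (l j)%:C) <= normc s * L.
  by rewrite normcM normc_real ler_wpM2l ?normc_ge0.
rewrite (le_trans (exp_taylor_remainder _ _))//.
  by rewrite (le_trans sl)// -ler_pdivlMr ?mul1r.
rewrite -[leRHS]mulrA ler_wpM2l ?mulr_ge0 ?exprn_ge0 ?expR_ge0//.
rewrite -exprMn lerXn2r ?nnegrE ?normc_ge0 ?mulr_ge0 ?normc_ge0 ?(ltW L0)//.
by rewrite [L * _]mulrC.
Qed.

(** The first nonzero moment, of order [p], gives a leading term [D * s ^+ p] that dominates the
    error of order [p.+1] near 0. *)
Lemma line_sum_isolated_zero a l j : injective l -> a j != 0 ->
  line_sum a l 0 = 0 ->
  exists2 r : R, 0 < r & forall s, s != 0 -> normc s <= r -> line_sum a l s != 0.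
Proof.
move=> injl aj; rewrite line_sum0 => M0.
have exM : exists p, (0 < p)%N && (moment a l p != 0).
  by have [p p0 Mp] := ex_moment_neq0 injl aj M0; exists p; rewrite p0.
case: (ex_minnP exM) => p /andP[p0 Mp] minp.
have Mq q : (0 < q < p)%N -> moment a l q = 0.
  move=> /andP[q0 qp]; apply: contrapT => /eqP Mq.
  by have := minp q; rewrite q0 Mq leqNgt qp => /(_ isT).
have [C [r [C0 r0 H]]] := line_sum_expansion p0 Mq.
pose D := moment a l p / p`!%:R.
have D0 : 0 < normc D.
  by rewrite normc_gt0 mulf_neq0// invr_eq0 pnatr_eq0 -lt0n fact_gt0.
(* Within the second radius the error is at most half of the leading term. *)
exists (Num.min r (normc D / (2 * C))).
  by rewrite lt_min r0 divr_gt0// mulr_gt0.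
move=> s s0; rewrite le_min => /andP[sr sD]; apply/eqP => ks.
have := H s sr; rewrite ks sub0r M0 add0r normcN normcM normcX exprS mulrA.
rewrite -/D ler_pM2r ?exprn_gt0 ?normc_gt0//.
move: sD; rewrite ler_pdivlMr ?mulr_gt0// => sD DC.
have : normc D * 2 <= normc D by rewrite (le_trans _ sD)//; nra.
by lra.
Qed.

(* Otherwise [k s = k 0 + D s^p + O(s^(p+1))] with [D != 0], and moving along
   a direction [zeta] with [D zeta^p = - k 0] decreases the modulus. *)
Lemma line_sum_min_modulus a l (d : R) : 0 < d -> line_sum a l 0 != 0 ->
  (forall s, normc s <= d -> normc (line_sum a l 0) <= normc (line_sum a l s)) ->
  forall s, line_sum a l s = line_sum a l 0.
Proof.
move=> d0 k0 mink s; apply: line_sum_const => p' p'0.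
apply: contrapT => /eqP Mp'.
have exM : exists p, (0 < p)%N && (moment a l p != 0) by exists p'; rewrite p'0.
case: (ex_minnP exM) => p /andP[p0 Mp] minp {p' p'0 Mp' exM}.
have Mq q : (0 < q < p)%N -> moment a l q = 0.
  move=> /andP[q0 qp]; apply: contrapT => /eqP Mq.
  by have := minp q; rewrite q0 Mq leqNgt qp => /(_ isT).
have [C [r [C0 r0 H]]] := line_sum_expansion p0 Mq.
set D := moment a l p / _ in H.
have D0 : D != 0 by rewrite mulf_neq0// invr_eq0 pnatr_eq0 -lt0n fact_gt0.
rewrite line_sum0 in k0 mink; set M0 := moment a l 0 in k0 mink H.
pose zeta := p.-root (- M0 / D).
have zetaE : zeta ^+ p = - M0 / D by rewrite rootCK.
have m0 : 0 < normc M0 by rewrite normc_gt0.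
pose z := normc zeta.
have z0 : 0 <= z by exact: normc_ge0.
(* Each summand encodes one smallness condition on [rho]: staying in the range of the expansion,
   staying in the disc of minimality, and having an error smaller than the gain. The choice
   [rho = (1 + S)^-1] meets all three. *)
pose S := z / r + z / d + C * z ^+ p.+1 / normc M0.
have S1 : 0 <= z / r by rewrite divr_ge0// ltW.
have S2 : 0 <= z / d by rewrite divr_ge0// ltW.
have S3 : 0 <= C * z ^+ p.+1 / normc M0.
  by rewrite divr_ge0 ?mulr_ge0 ?exprn_ge0// ltW.
pose rho := (1 + S)^-1.
have S1p : 0 < 1 + S by rewrite ltr_pwDl// /S !addr_ge0.
have rho0 : 0 < rho by rewrite invr_gt0.
have rhoP X : X <= S -> rho * X < 1.
  by move=> XS; rewrite mulrC ltr_pdivrMr// mul1r (le_lt_trans XS)// ltrDr.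
have zr : rho * z <= r.
  have := rhoP (z / r); rewrite mulrA ltr_pdivrMr// mul1r => /(_ _)/ltW; apply.
  by rewrite /S -addrA lerDl addr_ge0.
have zd : rho * z <= d.
  have := rhoP (z / d); rewrite mulrA ltr_pdivrMr// mul1r => /(_ _)/ltW; apply.
  by rewrite /S addrAC lerDr addr_ge0.
have zC : rho * (C * z ^+ p.+1) < normc M0.
  have := rhoP (C * z ^+ p.+1 / normc M0); rewrite mulrA ltr_pdivrMr// mul1r.
  by apply; rewrite /S lerDr addr_ge0.
have rho1 : rho <= 1 by rewrite invf_le1// lerDl /S !addr_ge0.
have nz : normc (rho%:C * zeta) = rho * z by rewrite normcM normc_real gtr0_norm.
have := mink (rho%:C * zeta); rewrite nz => /(_ zd); rewrite leNgt => /negP; apply.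
have := H (rho%:C * zeta); rewrite nz => /(_ zr).
(* The modulus of the main term drops by [rho ^+ p * normc M0], more than the error, at most
   [C * (rho * z) ^+ p.+1], can restore. *)
have -> : M0 + D * (rho%:C * zeta) ^+ p = (1 - rho ^+ p)%:C * M0.
  rewrite exprMn zetaE rmorphB rmorph1 rmorphXn /=.
  by field.
set k := line_sum _ _ _ => Hk.
have -> : k = (1 - rho ^+ p)%:C * M0 + (k - (1 - rho ^+ p)%:C * M0).
  by rewrite addrC subrK.
rewrite (le_lt_trans (normcD_le _ _))// normcM normc_real ger0_norm; last first.
  by rewrite subr_ge0 exprn_ile1// ltW.
rewrite mulrBl mul1r -addrA gtrDl addrC subr_lt0 (le_lt_trans Hk)//.
rewrite exprMn exprS mulrCA [ltLHS](_ : _ = rho ^+ p * (rho * (C * z ^+ p.+1))).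
  by rewrite ltr_pM2l// exprn_gt0.
by ring.
Qed.

End OneVariableSums.

(** * The torus of limits of imaginary translates *)

Lemma continuous_idfun (T : topologicalType) : continuous (fun t : T => t).
Proof. by move=> t; exact: cvg_id. Qed.

Lemma continuous_fst (U V : topologicalType) : continuous (@fst U V).
Proof. by move=> q; exact: cvg_fst. Qed.

Lemma continuous_snd (U V : topologicalType) : continuous (@snd U V).
Proof. by move=> q; exact: cvg_snd. Qed.

Section Continuity.
Variables (R : realType) (T : topologicalType).
Implicit Types f g : T -> R.

Lemma continuous_add f g :
  continuous f -> continuous g -> continuous (fun t => f t + g t).
Proof. by move=> cf cg t; apply: cvgD; [exact: cf|exact: cg]. Qed.

Lemma continuous_sub f g :
  continuous f -> continuous g -> continuous (fun t => f t - g t).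
Proof. by move=> cf cg t; apply: cvgB; [exact: cf|exact: cg]. Qed.

Lemma continuous_mul f g :
  continuous f -> continuous g -> continuous (fun t => f t * g t).
Proof. by move=> cf cg t; apply: cvgM; [exact: cf|exact: cg]. Qed.

Lemma continuous_sum (I : Type) (r : seq I) (P : pred I) (F : I -> T -> R) :
  (forall i, continuous (F i)) ->
  continuous (fun t => \sum_(i <- r | P i) F i t).
Proof. by move=> cF; apply: continuous_big => //; exact: add_continuous. Qed.

Lemma continuous_compose (U V : topologicalType) (g : T -> U) (h : U -> V) :
  continuous g -> continuous h -> continuous (fun t => h (g t)).
Proof. by move=> cg ch t; apply: continuous_comp; [exact: cg|exact: ch]. Qed.

Lemma continuous_pair (U V : topologicalType) (g : T -> U) (h : T -> V) :
  continuous g -> continuous h -> continuous (fun t => (g t, h t)).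
Proof. by move=> cg ch t; apply: cvg_pair; [exact: cg|exact: ch]. Qed.

Lemma continuous_row n (F : 'I_n -> T -> R) :
  (forall j, continuous (F j)) -> continuous (fun t => \row_j F j t).
Proof.
move=> cF t A [P Pn PA]; rewrite nbhs_simpl /=.
have : \forall s \near t, forall j, P ord0 j (F j s).
  apply: filter_forall => j; apply: (cF j t).
  by have := Pn ord0 j; rewrite mxE.
by apply: filterS => s Ps; apply: PA => i j; rewrite mxE (ord1 i).
Qed.

Lemma continuous_mulmx_row n N (A : 'M[R]_(n, N)) (x : T -> 'rV[R]_n) j :
  continuous x -> continuous (fun t => (x t *m A) 0 j).
Proof.
move=> cx; rewrite (_ : (fun t => _) = fun t => \sum_k x t 0 k * A k j); last first.
  by apply/funext => t; rewrite mxE.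
apply: continuous_sum => k; apply: continuous_mul; last exact: cst_continuous.
exact: (continuous_compose (h := fun M : 'rV[R]_n => M 0 k) cx
  (@coord_continuous _ _ _ _ _)).
Qed.

Lemma continuous_line n (a v : T -> 'rV[R]_n) (u : T -> R) :
  continuous a -> continuous u -> continuous v ->
  continuous (fun t => a t + u t *: v t).
Proof.
by move=> ca cu cv t; apply: cvgD; [exact: ca|apply: cvgZ; [exact: cu|exact: cv]].
Qed.

End Continuity.

(** This is the tube lemma for a strict inequality. *)
Lemma near_forall_compact_gt (R : realType) (T U : topologicalType) (K : set U)
    (h : T -> U -> R) (b : R) (t0 : T) :
  compact K -> continuous (fun q : T * U => h q.1 q.2) ->
  (forall w, K w -> b < h t0 w) ->
  \forall t \near t0, forall w, K w -> b < h t w.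
Proof.
move=> cK ch Kb; have /compact_near_coveringP := cK.
move=> /(_ T (nbhs t0) (fun t w => b < h t w)); apply.
move=> w Kw.
have : \forall q \near (t0, w), b < h q.1 q.2.
  by apply: (@cvgr_gt _ _ _ _ _ _ (ch (t0, w))); exact: Kb.
case=> -[A B] /= [At Bw] AB.
by exists (B, A) => // -[w' t'] [/= Bw' At']; exact: (AB (t', w')).
Qed.

Lemma connected_rV_line (R : realType) n (v : 'rV[R]_n) :
  connected (range (fun t : R => t *: v)).
Proof.
apply: connected_continuous_connected.
  by apply/connected_intervalP => x y _ _ z _.
apply: continuous_subspaceT.
rewrite (_ : (fun t => _) = fun t => 0 + t *: v).
  by apply: continuous_line; [exact: cst_continuous|exact: continuous_idfun|
    exact: cst_continuous].
by apply/funext => t; rewrite add0r.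
Qed.

Section Torus.
Variables (R : realType) (N : nat).
Notation CV := ('rV[R]_N * 'rV[R]_N)%type.
Implicit Types (c w : CV).

(* Complex vectors are encoded as pairs of real rows, whose topology is that of
   [R]. *)
Definition cpx c j : R[i] := c.1 0 j +i* c.2 0 j.

Definition cmul c w : CV :=
  (\row_j (c.1 0 j * w.1 0 j - c.2 0 j * w.2 0 j),
   \row_j (c.1 0 j * w.2 0 j + c.2 0 j * w.1 0 j)).

Lemma cpx_inj c w : cpx c =1 cpx w -> c = w.
Proof.
case: c w => [c1 c2] [w1 w2] E.
by congr pair; apply/rowP => j; have [] := E j.
Qed.

Lemma cpx_cmul c w j : cpx (cmul c w) j = cpx c j * cpx w j.
Proof. by rewrite /cpx /cmul /= !mxE. Qed.

Lemma continuous_cpx_Re (T : topologicalType) (c : T -> CV) j :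
  continuous c -> continuous (fun t => complex.Re (cpx (c t) j)).
Proof.
move=> cc; apply: (continuous_compose (h := fun M : 'rV[R]_N => M 0 j)).
  exact: (continuous_compose cc (@continuous_fst _ _)).
exact: coord_continuous.
Qed.

Lemma continuous_cpx_Im (T : topologicalType) (c : T -> CV) j :
  continuous c -> continuous (fun t => complex.Im (cpx (c t) j)).
Proof.
move=> cc; apply: (continuous_compose (h := fun M : 'rV[R]_N => M 0 j)).
  exact: (continuous_compose cc (@continuous_snd _ _)).
exact: coord_continuous.
Qed.

Lemma continuous_cmul (T : topologicalType) (c w : T -> CV) :
  continuous c -> continuous w -> continuous (fun t => cmul (c t) (w t)).
Proof.
move=> cc cw.
have re (d : T -> CV) j := @continuous_cpx_Re _ d j.
have im (d : T -> CV) j := @continuous_cpx_Im _ d j.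
apply: continuous_pair; apply: continuous_row => j.
  by apply: continuous_sub; apply: continuous_mul;
    [exact: re|exact: re|exact: im|exact: im].
by apply: continuous_add; apply: continuous_mul;
  [exact: re|exact: im|exact: im|exact: re].
Qed.

Lemma continuous_normc (T : topologicalType) (z : T -> R[i]) :
  continuous (fun t => complex.Re (z t)) -> continuous (fun t => complex.Im (z t)) ->
  continuous (fun t => normc (z t)).
Proof.
move=> cre cim; rewrite (_ : (fun t => _) = fun t =>
    Num.sqrt (complex.Re (z t) * complex.Re (z t) +
              complex.Im (z t) * complex.Im (z t))); last first.
  by apply/funext => t; case: (z t).
apply: (continuous_compose (h := @Num.sqrt R)); last exact: sqrt_continuous.
by apply: continuous_add; apply: continuous_mul.
Qed.

Section Phases.
Variables (d : nat) (A : 'M[R]_(d, N)).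
Implicit Types x y : 'rV[R]_d.

Definition phase y : CV :=
  (\row_j cos ((y *m A) 0 j), \row_j sin ((y *m A) 0 j)).

Definition torus : set CV := closure (range phase).

Lemma cpx_phase y j : cpx (phase y) j = expC (0 +i* (y *m A) 0 j).
Proof. by rewrite /cpx /phase /expC /= !mxE expR0 mul1r. Qed.

Lemma phaseD y y' : phase (y + y') = cmul (phase y) (phase y').
Proof.
apply: cpx_inj => j; rewrite cpx_cmul !cpx_phase -expCD mulmxDl mxE.
by congr expC; apply/eqP; rewrite eq_complex /= addr0 !eqxx.
Qed.

Lemma phase0 j : cpx (phase 0) j = 1.
Proof. by rewrite cpx_phase mul0mx mxE [_ +i* _](_ : _ = 0) ?expC0. Qed.

Lemma continuous_phase (T : topologicalType) (y : T -> 'rV[R]_d) :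
  continuous y -> continuous (fun t => phase (y t)).
Proof.
move=> cy; apply: continuous_pair; apply: continuous_row => j.
  exact: (continuous_compose (h := @cos R) (@continuous_mulmx_row _ _ _ _ A _ j cy)
    (@continuous_cos R)).
exact: (continuous_compose (h := @sin R) (@continuous_mulmx_row _ _ _ _ A _ j cy)
  (@continuous_sin R)).
Qed.

Lemma torus_phase y : torus (phase y).
Proof. by apply: subset_closure; exists y. Qed.

(** Multiplication by a phase is continuous and preserves the set of phases, hence also its
    closure. *)
Lemma torus_cmul_phase w y : torus w -> torus (cmul w (phase y)).
Proof.
move=> Tw.
have cm : continuous (fun w : CV => cmul w (phase y)).
  by apply: continuous_cmul; [exact: continuous_idfun|exact: cst_continuous].
move=> B /(cm w) /Tw [_ [[y' _ <-] By']].
by exists (cmul (phase y') (phase y)); split => //; exists (y' + y); rewrite ?phaseD.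
Qed.

(** Closed conditions pass from phases to their limits. *)
Lemma torus_ind (P : set CV) : closed P -> (forall y, P (phase y)) -> torus `<=` P.
Proof.
move=> cP PA; rewrite (iffLR (closure_id _) cP); apply: closureS => _ [y _ <-]; exact: PA.
Qed.

Lemma normc_torus w j : torus w -> normc (cpx w j) = 1.
Proof.
pose P := (fun w => normc (cpx w j)) @^-1` [set x | x = 1].
apply: (@torus_ind P) => [|y]; last first.
  by rewrite -[P _]/(normc (cpx (phase y) j) = 1) cpx_phase normc_expC expR0.
apply: preimage_closed; last exact: closed_eq.
by move=> v _; apply: continuous_normc; [apply: continuous_cpx_Re; exact: continuous_idfun|
  apply: continuous_cpx_Im; exact: continuous_idfun].
Qed.

Lemma compact_torus : compact torus.
Proof.
pose box : set 'rV[R]_N := [set v | forall j, `[-1, 1]%classic (v ord0 j)].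
have cbox : compact box.
  by apply: (@rV_compact R N (fun=> `[-1, 1]%classic)) => j; exact: segment_compact.
apply: (subclosed_compact (@closed_closure _ _) (compact_setX cbox cbox)).
move=> w Tw; split=> j; rewrite /= in_itv /= -ler_norml.
  by rewrite -(normc_torus j Tw); exact: (normc_ge_absRe (cpx w j)).
by rewrite -(normc_torus j Tw); exact: (normc_ge_absIm (cpx w j)).
Qed.

(** The phases form a union of images of lines through the origin, all containing [phase 0]. *)
Lemma connected_torus : connected torus.
Proof.
apply: connected_closure.
have -> : range phase = \bigcup_(v in [set: 'rV[R]_d]) (phase @` range (fun t : R => t *: v)).
  apply/seteqP; split => [_ [v _ <-]|_ [v _ [_ [t _ <-] <-]]].
    by exists v => //; exists v => //; exists 1 => //; rewrite scale1r.
  by exists (t *: v).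
apply: bigcup_connected => [|v _].
  by exists (phase 0) => v _; exists 0 => //; exists 0 => //; rewrite scale0r.
apply: connected_continuous_connected; first exact: connected_rV_line.
by apply: continuous_subspaceT; apply: continuous_phase; exact: continuous_idfun.
Qed.

(* [twisted_sum c w x] is the value at [x + i y] of the exponential sum with
   coefficients [c] when [w = phase y]; points [w] of the torus give the values
   of limits of imaginary translates. *)
Definition twisted_sum c w x : R[i] :=
  \sum_j cpx c j * cpx w j * (expR ((x *m A) 0 j))%:C.

Lemma continuous_normc_twisted_sum (T : topologicalType)
    (c w : T -> CV) (x : T -> 'rV[R]_d) :
  continuous c -> continuous w -> continuous x ->
  continuous (fun t => normc (twisted_sum (c t) (w t) (x t))).
Proof.
move=> cc cw cx.
have ce j : continuous (fun t => expR ((x t *m A) 0 j)).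
  exact: (continuous_compose (h := @expR R) (@continuous_mulmx_row _ _ _ _ A _ j cx)
    (@continuous_expR R)).
have cm := continuous_cmul cc cw.
apply: continuous_normc.
  rewrite (_ : (fun t => _) =
      fun t => \sum_j complex.Re (cpx (cmul (c t) (w t)) j) * expR ((x t *m A) 0 j)).
    apply: continuous_sum => j; apply: continuous_mul => //.
    exact: continuous_cpx_Re.
  apply/funext => t; rewrite (raddf_sum (@complex.Re R)); apply: eq_bigr => j _.
  by rewrite -cpx_cmul; case: (cpx _ j) => a b /=; rewrite mulr0 subr0.
rewrite (_ : (fun t => _) =
    fun t => \sum_j complex.Im (cpx (cmul (c t) (w t)) j) * expR ((x t *m A) 0 j)).
  apply: continuous_sum => j; apply: continuous_mul => //.
  exact: continuous_cpx_Im.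
apply/funext => t; rewrite (raddf_sum (@complex.Im R)); apply: eq_bigr => j _.
by rewrite -cpx_cmul; case: (cpx _ j) => a b /=; rewrite mulr0 add0r.
Qed.

(** On the complex line through [x] with direction [v], the real part of [s] moves the point and the
    imaginary part rotates the phases. This makes the one-variable results applicable. *)
Lemma line_sum_twisted c w x v (s : R[i]) :
  line_sum (fun j => cpx c j * cpx w j * (expR ((x *m A) 0 j))%:C)
    (fun j => (v *m A) 0 j) s =
  twisted_sum c (cmul w (phase (complex.Im s *: v))) (x + complex.Re s *: v).
Proof.
apply: eq_bigr => j _; rewrite cpx_cmul cpx_phase mulmxDl -!scalemxAl !mxE expRD.
set l := \sum_(k < d) _; set m := \sum_k _.
have -> : expC (s * m%:C) =
    expC (0 +i* (complex.Im s * m)) * (expR (complex.Re s * m))%:C.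
  case: s => a b; rewrite /expC /= expR0; apply/eqP; rewrite eq_complex /=.
  rewrite !(mul0r, mulr0, mul1r, subr0, addr0, add0r).
  by rewrite ![expR _ * _]mulrC !eqxx.
rewrite (rmorphM (real_complex R)); move: (expC _) => y; ring.
Qed.

End Phases.
End Torus.

(** * Nonvanishing above segments *)

Section UniformNonvanishing.
Variables (R : realType) (d N : nat) (A : 'M[R]_(d, N)).
Notation CV := ('rV[R]_N * 'rV[R]_N)%type.
Implicit Types (c w : CV) (x p v : 'rV[R]_d).

Definition nonvanishing c x := forall w, torus A w -> twisted_sum A c w x != 0.

Definition segment_nonvanishing x0 c p :=
  forall u : R, 0 <= u <= 1 -> nonvanishing c (x0 + u *: (p - x0)).

Lemma nonvanishing_near c x : nonvanishing c x ->
  \forall x' \near x, nonvanishing c x'.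
Proof.
move=> cx; have ct : continuous (fun q : 'rV[R]_d * CV => normc (twisted_sum A c q.2 q.1)).
  apply: continuous_normc_twisted_sum; [exact: cst_continuous|..].
    exact: continuous_snd.
  exact: continuous_fst.
have := near_forall_compact_gt (h := fun x w => normc (twisted_sum A c w x))
  (b := 0) (t0 := x) (@compact_torus _ _ _ A) ct.
case=> [w Tw|e e0 eP]; first by rewrite normc_gt0 cx.
by exists e => // x' /eP H w Tw; rewrite -normc_gt0 H.
Qed.

(* On the closed strip the modulus is minimal, over all imaginary translates
   and their limits, at some point; by the minimum modulus principle such a
   point can be moved to the boundary. *)
Lemma strip_lower_bound x0 c p (e : R) : segment_nonvanishing x0 c p ->
  (forall w, torus A w -> e <= normc (twisted_sum A c w x0)) ->
  (forall w, torus A w -> e <= normc (twisted_sum A c w p)) ->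
  forall w u, torus A w -> 0 <= u <= 1 ->
    e <= normc (twisted_sum A c w (x0 + u *: (p - x0))).
Proof.
move=> cp e0 e1 w u Tw u01; set v := p - x0.
pose K := torus A `*` (`[0, 1]%classic : set R).
pose h (q : CV * R) := normc (twisted_sum A c q.1 (x0 + q.2 *: v)).
have cK : compact K by apply: compact_setX; [exact: compact_torus|exact: segment_compact].
have ch : continuous h.
  apply: continuous_normc_twisted_sum;
    [exact: cst_continuous|exact: continuous_fst|].
  by apply: (continuous_line (a := fun=> x0) (u := snd) (v := fun=> v));
    [exact: cst_continuous|exact: continuous_snd|exact: cst_continuous].
have inK w' u' : torus A w' -> 0 <= u' <= 1 -> (w', u') \in K.
  by move=> Tw' u01'; apply/mem_set; split => //=; rewrite in_itv.
have K0 : K !=set0 by exists (w, u); apply/set_mem/inK.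
have [[w1 u1] /set_mem[/= Tw1] u1P hmin] :=
  compact_EVT_min K0 cK (continuous_subspaceT ch).
rewrite (le_trans _ (hmin (w, u) (inK _ _ Tw u01)))// {w u Tw u01}.
move: u1P; rewrite in_itv /= => /andP[]; rewrite [0 <= _]le_eqVlt => /predU1P[<-|u1_gt0].
  by move=> _; rewrite /h /= scale0r addr0 e0.
rewrite le_eqVlt => /predU1P[->|u1_lt1].
  by rewrite /h /= scale1r addrC subrK e1.
have lsE := line_sum_twisted A c w1 (x0 + u1 *: v) v.
set k := line_sum _ _ in lsE.
have kE s : k s =
    twisted_sum A c (cmul w1 (phase A (complex.Im s *: v))) (x0 + (u1 + complex.Re s) *: v).
  by rewrite lsE scalerDl addrA.
have w1E : cmul w1 (phase A (0 *: v)) = w1.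
  by apply: cpx_inj => j; rewrite cpx_cmul scale0r phase0 mulr1.
have kh : normc (k 0) = h (w1, u1) by rewrite kE /= w1E addr0.
(* Nonvanishing on the segment excludes the minimum 0, for which the minimum modulus principle
   fails. *)
have k0 : k 0 != 0.
  by rewrite kE /= w1E addr0; apply: cp => //; rewrite (ltW u1_gt0) (ltW u1_lt1).
(* The disc of radius [r] about [u1] stays in the strip. *)
pose r := Num.min u1 (1 - u1).
have r0 : 0 < r by rewrite lt_min u1_gt0 subr_gt0.
have kmin s : normc s <= r -> normc (k 0) <= normc (k s).
  move=> sr; rewrite kh kE; apply: (hmin (_, _)); apply: inK; first exact: torus_cmul_phase.
  have := le_trans (normc_ge_absRe s) sr.
  rewrite /r le_min !ler_norml; move: (complex.Re s) => t.
  case/andP => /andP[t1 _] /andP[_ t2].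
  by rewrite -lerBlDl sub0r t1 -lerBrDl.
(* Constancy on the complex line carries the minimum to the end point [x0], at [s = - u1]. *)
have := line_sum_min_modulus r0 k0 kmin (- u1)%:C.
rewrite -kh -/k => <-; rewrite kE /= w1E subrr scale0r addr0.
exact: e0.
Qed.

(** The good pairs form an open set by compactness, and a relatively closed one in [S] by
    [strip_lower_bound]. *)
Lemma segment_nonvanishing_connected (S : set (CV * 'rV[R]_d)) x0 q0 :
  connected S -> S q0 -> segment_nonvanishing x0 q0.1 q0.2 ->
  (forall q, S q -> nonvanishing q.1 x0 /\ nonvanishing q.1 q.2) ->
  forall q, S q -> segment_nonvanishing x0 q.1 q.2.
Proof.
move=> cS Sq0 q0G Sends.
pose h (q : CV * 'rV[R]_d) (wu : CV * R) :=
  normc (twisted_sum A q.1 wu.1 (x0 + wu.2 *: (q.2 - x0))).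
have ch : continuous (fun q => h q.1 q.2).
  apply: continuous_normc_twisted_sum.
  - exact: (continuous_compose (@continuous_fst _ _) (@continuous_fst _ _)).
  - exact: (continuous_compose (@continuous_snd _ _) (@continuous_fst _ _)).
  pose T : Type := (CV * 'rV[R]_d * (CV * R))%type.
  apply: (continuous_line (a := fun=> x0) (u := fun t : T => t.2.2)
    (v := fun t : T => t.1.2 - x0)); first exact: cst_continuous.
    exact: (continuous_compose (@continuous_snd _ _) (@continuous_snd _ _)).
  move=> q; apply: cvgB; last exact: cvg_cst.
  exact: (continuous_compose (@continuous_fst _ _) (@continuous_snd _ _)).
pose G := [set q | segment_nonvanishing x0 q.1 q.2].
pose K := torus A `*` (`[0, 1]%classic : set R).
have cK : compact K by apply: compact_setX; [exact: compact_torus|exact: segment_compact].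
have openG : open G.
  rewrite openE => q Gq.
  have : forall wu, K wu -> 0 < h q wu.
    by move=> [w u] [/= Tw]; rewrite in_itv /= => u01; rewrite normc_gt0 Gq.
  move=> /(near_forall_compact_gt cK ch); apply: filterS => q' Kq' u u01 w Tw.
  by rewrite -normc_gt0; apply: (Kq' (w, u)); split => //=; rewrite in_itv.
have closedG : S `&` closure G `<=` G.
  move=> q [Sq clG] u u01 w Tw; apply/negP => /eqP qwu0.
  have [qx0 qp] := Sends _ Sq.
  pose K' := torus A `*` ([set 0] `|` [set 1] : set R).
  have cK' : compact K'.
    by apply: compact_setX; [exact: compact_torus|apply: compactU; exact: compact_set1].
  (* [e] is half the minimal modulus over the two end points, so that strict bounds persist for
     nearby pairs. *)
  have [e e0 eK] : exists2 e, 0 < e & forall wu, K' wu -> e < h q wu.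
    have chq : continuous (h q).
      apply: (continuous_compose (g := fun wu => (q, wu)) _ ch).
      by apply: continuous_pair; [exact: cst_continuous|exact: continuous_idfun].
    have K'0 : K' !=set0 by exists (phase A 0, 0); split; [exact: torus_phase|left].
    have [wu /set_mem K'wu hmin] := compact_EVT_min K'0 cK' (continuous_subspaceT chq).
    have hwu : 0 < h q wu.
      case: wu K'wu {hmin} => w' u' [/= Tw' [->|->]]; rewrite /h /= normc_gt0.
        by rewrite scale0r addr0 qx0.
      by rewrite scale1r addrC subrK qp.
    exists (h q wu / 2) => [|wu' K'wu']; first by rewrite divr_gt0.
    by rewrite (lt_le_trans _ (hmin _ (mem_set K'wu')))// gtr_pMr// invf_lt1// ltr1n.
  have near1 := near_forall_compact_gt cK' ch eK.
  have near2 : \forall q' \near q, h q' (w, u) < e.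
    have chw : continuous (fun q' => h q' (w, u)).
      apply: (continuous_compose (g := fun q' => (q', (w, u))) _ ch).
      by apply: continuous_pair; [exact: continuous_idfun|exact: cst_continuous].
    apply: (@cvgr_lt _ _ _ _ _ _ (chw q)).
    by rewrite /h /= qwu0 normc0.
  (* A good pair near [q] exceeds [e] at both end points but not at [(w, u)], against the strip
     bound. *)
  have [q' [Gq' [q'e /= q'wu]]] := clG _ (filterI near1 near2).
  have := @strip_lower_bound x0 q'.1 q'.2 e Gq' _ _ w u Tw u01.
  rewrite leNgt q'wu; case/(_ _ _)/negP; last by [].
  - move=> w' Tw'; have := q'e (w', 0); rewrite /h /= scale0r addr0 => /(_ _)/ltW; apply.
    by split => //; left.
  - move=> w' Tw'; have := q'e (w', 1); rewrite /h /= scale1r addrC subrK => /(_ _)/ltW; apply.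
    by split => //; right.
move=> q Sq; suff : S `&` G = S by move=> E; have := Sq; rewrite -{1}E => -[].
apply: cS; first by exists q0.
  by exists G.
exists (closure G); first exact: closed_closure.
apply/seteqP; split => q' [Sq' Gq']; split => //; first exact: subset_closure.
exact: closedG.
Qed.

End UniformNonvanishing.

(** * Amoebas and caissons *)

Section Amoebas.
Variables (R : realType) (N : nat).
Notation CV := ('rV[R]_N * 'rV[R]_N)%type.
Implicit Types c : 'rV[R[i]]_N.

Definition cvec c : CV := (map_mx (@complex.Re R) c, map_mx (@complex.Im R) c).

Lemma cpx_cvec c j : cpx (cvec c) j = c 0 j.
Proof. by rewrite /cpx /= !mxE; case: (c 0 j). Qed.

Lemma expsum_twisted_sum d (A : 'M[R]_(d, N)) c z :
  expsum A c z = twisted_sum A (cvec c) (phase A (map_mx (@complex.Im R) z))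
    (map_mx (@complex.Re R) z).
Proof.
apply: eq_bigr => j _; rewrite cpx_cvec cpx_phase -mulrA; congr (_ * _).
have -> : pairing A z j = (map_mx (@complex.Re R) z *m A) 0 j +i*
    (map_mx (@complex.Im R) z *m A) 0 j.
  apply/eqP; rewrite eq_complex /= (raddf_sum (@complex.Re R)) (raddf_sum (@complex.Im R)).
  rewrite !mxE; apply/andP; split; apply/eqP; apply: eq_bigr => k _; rewrite !mxE;
    by case: (z 0 k) => a b /=; rewrite mulr0 ?subr0 ?add0r.
by rewrite /expC /= expR0 mul1r mulrC.
Qed.

Lemma expsum_phase d (A : 'M[R]_(d, N)) c x y :
  twisted_sum A (cvec c) (phase A y) x = expsum A c (\row_k (x 0 k +i* y 0 k)).
Proof.
rewrite expsum_twisted_sum; congr (twisted_sum _ _ (phase _ _) _);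
  by apply/rowP => k; rewrite !mxE.
Qed.

(** Nonvanishing is an open condition, and a zero of the exponential sum is a zero of a twisted sum
    at a phase. *)
Lemma nonvanishing_notin_amoeba d (A : 'M[R]_(d, N)) c x :
  nonvanishing A (cvec c) x -> ~ amoeba (expsum A c) x.
Proof.
move=> /nonvanishing_near cx /(_ _ cx)[_ [[z z0 <-] Nz]].
have := Nz _ (@torus_phase _ _ _ A (map_mx (@complex.Im R) z)).
by rewrite -expsum_twisted_sum => /eqP; apply.
Qed.

(** The zero sum has the whole space as its amoeba. *)
Lemma notin_amoeba_coef_neq0 d (A : 'M[R]_(d, N)) c x :
  ~ amoeba (expsum A c) x -> exists j, c 0 j != 0.
Proof.
move=> xA; apply: contrapT => c0; apply: xA; apply: subset_closure.
exists (\row_k (x 0 k +i* 0)); last by apply/rowP => k; rewrite !mxE.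
apply: big1 => j _; suff -> : c 0 j = 0 by rewrite mul0r.
by apply: contrapT => /eqP cj; apply: c0; exists j.
Qed.

(* Hurwitz's theorem along a direction separating the exponents: a zero of a
   limit of imaginary translates is isolated on a complex line, hence forces
   zeros of nearby imaginary translates, by the minimum modulus principle. *)
Lemma notin_amoeba_nonvanishing d (A : 'M[R]_(d, N)) c x :
  injective (fun j : 'I_N => col j A) ->
  ~ amoeba (expsum A c) x -> nonvanishing A (cvec c) x.
Proof.
move=> injA xA w Tw; apply/negP => /eqP wx0.
have [j0 cj0] := notin_amoeba_coef_neq0 xA.
have [v injv] := ex_separating injA.
pose a w j := cpx (cvec c) j * cpx w j * (expR ((x *m A) 0 j))%:C.
pose l j := (v *m A) 0 j.
pose k w s := line_sum (a w) l s.
have kE w' s : k w' s = twisted_sum A (cvec c)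
    (cmul w' (phase A (complex.Im s *: v))) (x + complex.Re s *: v).
  exact: line_sum_twisted.
have k0E w' : k w' 0 = twisted_sum A (cvec c) w' x.
  rewrite kE /= !scale0r addr0; congr twisted_sum.
  by apply: cpx_inj => j; rewrite cpx_cmul phase0 mulr1.
have aj0 : a w j0 != 0.
  rewrite !mulf_neq0 ?cpx_cvec //; last by rewrite (inj_eq (@complexI R)) gt_eqF ?expR_gt0.
  by rewrite -normc_eq0 (normc_torus _ Tw) oner_eq0.
have kw0 : line_sum (a w) l 0 = 0 by rewrite -/(k w 0) k0E.
have [r r0 isol] := line_sum_isolated_zero injv aj0 kw0.
have : \forall t \near (0 : R), ~ amoeba (expsum A c) (x + t *: v).
  have cl : continuous (fun t : R => x + t *: v).
    by apply: continuous_line; [exact: cst_continuous|exact: continuous_idfun|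
      exact: cst_continuous].
  have : nbhs (x + 0 *: v) (~` amoeba (expsum A c)).
    rewrite scale0r addr0; apply: open_nbhs_nbhs; split => //.
    by apply: closed_openC; exact: closed_closure.
  exact: cl.
case=> delta delta0 deltaA.
(* The square of half-side [rho] fits into the disc where the zero is isolated, and its real parts
   stay strictly below [delta]. *)
pose rho := Num.min (r / 2) (delta / 2).
have rho0 : 0 < rho by rewrite lt_min !divr_gt0.
pose z (s : R * R) : R[i] := s.1 +i* s.2.
pose sq : set (R * R) := `[- rho, rho]%classic `*` `[- rho, rho]%classic.
have csq : compact sq by apply: compact_setX; exact: segment_compact.
(* The norm on [R * R] is the maximum norm, so [K] is the boundary of the square. *)
pose K : set (R * R) := sq `&` [set s | `|s| = rho].
have cK : compact K.
  apply: compact_closedI => //.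
  apply: (@preimage_closed _ _ (fun s : R * R => `|s|) [set y | y = rho]).
    by move=> s _; exact: norm_continuous.
  exact: closed_eq.
have sqE s : sq s <-> `|s| <= rho.
  rewrite /sq /= !in_itv /= -!ler_norml prod_normE ge_max.
  by split=> [[-> ->]|/andP].
have zr s : sq s -> normc (z s) <= r.
  move=> /sqE; rewrite prod_normE ge_max => /andP[h1 h2].
  rewrite (le_trans (normc_le_ReIm _))//= (le_trans (lerD h1 h2))//.
  by rewrite -mulr2n -mulr_natr -ler_pdivlMr// ge_min lexx.
pose h (w' : CV) (s : R * R) := normc (k w' (z s)).
have ch : continuous (fun q => h q.1 q.2).
  pose T : Type := (CV * (R * R))%type.
  rewrite (_ : (fun q => _) = fun q : T => normc (twisted_sum A (cvec c)
    (cmul q.1 (phase A (0 + q.2.2 *: v))) (x + q.2.1 *: v))).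
    have c21 : continuous (fun q : T => q.2.1).
      exact: (continuous_compose (@continuous_snd _ _) (@continuous_fst _ _)).
    have c22 : continuous (fun q : T => q.2.2).
      exact: (continuous_compose (@continuous_snd _ _) (@continuous_snd _ _)).
    have cline (u : T -> R) x' : continuous u -> continuous (fun q => x' + u q *: v).
      by move=> cu; apply: (continuous_line (a := fun=> x') (v := fun=> v)) => //;
        exact: cst_continuous.
    apply: continuous_normc_twisted_sum; first exact: cst_continuous.
      apply: continuous_cmul; first exact: continuous_fst.
      by apply: continuous_phase; exact: cline.
    exact: cline.
  by apply/funext => -[w' s]; rewrite /h kE add0r.
have K0 : K (rho, 0).
  have E : `|(rho, 0) : R * R| = rho.
    by rewrite prod_normE /= normr0 gtr0_norm// max_l// ltW.
  by split => //; apply/sqE; rewrite E.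
have [e e0 eK] : exists2 e, 0 < e & forall s, K s -> e < h w s.
  have chw : continuous (h w).
    apply: (continuous_compose (g := fun s => (w, s)) _ ch).
    by apply: continuous_pair; [exact: cst_continuous|exact: continuous_idfun].
  have [s /set_mem Ks hmin] := compact_EVT_min (ex_intro _ _ K0) cK (continuous_subspaceT chw).
  have hs : 0 < h w s.
    rewrite normc_gt0; case: Ks => sqs srho; apply: isol; last exact: zr.
    apply/eqP => -[s10 s20]; move: srho; rewrite /= prod_normE s10 s20 normr0 maxxx.
    by move=> rho00; rewrite -rho00 ltxx in rho0.
  exists (h w s / 2) => [|s' Ks']; first by rewrite divr_gt0.
  by rewrite (lt_le_trans _ (hmin _ (mem_set Ks')))// gtr_pMr// invf_lt1// ltr1n.
have near1 := near_forall_compact_gt cK ch eK.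
have near2 : \forall w' \near w, h w' 0 < e.
  have chw : continuous (fun w' => h w' 0).
    apply: (continuous_compose (g := fun w' : CV => (w', 0 : R * R)) _ ch).
    by apply: continuous_pair; [exact: continuous_idfun|exact: cst_continuous].
  apply: (@cvgr_lt _ _ _ _ _ _ (chw w)).
  by rewrite /h (_ : z 0 = 0) // k0E wx0 normc0.
(* A phase close to [w] keeps the modulus above [e] on the boundary and below [e] at the centre,
   which forces an interior minimum [s1]. *)
have [_ [[y _ <-] [yK y0]]] := Tw _ (filterI near1 near2).
set w' := phase A y in yK y0.
have sq0 : sq 0 by apply/sqE; rewrite normr0 ltW.
have [s1 /set_mem sqs1 hmin] : exists2 s1, s1 \in sq & forall s, s \in sq -> h w' s1 <= h w' s.
  apply: compact_EVT_min => //; first by exists 0.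
  apply: continuous_subspaceT.
  apply: (continuous_compose (g := fun s => (w', s)) _ ch).
  by apply: continuous_pair; [exact: cst_continuous|exact: continuous_idfun].
have s1e : h w' s1 < e by rewrite (le_lt_trans (hmin 0 _))// mem_set.
have s1_lt : `|s1| < rho.
  rewrite lt_neqAle; move/sqE : (sqs1) => ->; rewrite andbT; apply/eqP => s1rho.
  by have := yK s1 (conj sqs1 s1rho); rewrite ltNge ltW.
pose a1 j := a w' j * expC (z s1 * (l j)%:C).
have k1E s : line_sum a1 l s = k w' (z s1 + s) by rewrite /k line_sum_shift.
pose eta := rho - `|s1|.
have eta0 : 0 < eta by rewrite subr_gt0.
(* The minimum is a value of the exponential sum itself, above a point outside the amoeba. *)
have k10 : line_sum a1 l 0 != 0.
  rewrite k1E addr0 kE /w' -phaseD expsum_phase; apply/eqP => f0.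
  apply: (deltaA s1.1).
    rewrite /= sub0r normrN (@le_lt_trans _ _ rho)//.
      by move: sqs1 => -[]; rewrite /= in_itv /= -ler_norml.
    by rewrite gt_min; apply/orP; right; rewrite gtr_pMr// invf_lt1// ltr1n.
  apply: subset_closure; eexists; first exact: f0.
  by apply/rowP => j; rewrite !mxE.
have k1min s : normc s <= eta -> normc (line_sum a1 l 0) <= normc (line_sum a1 l s).
  move=> seta; rewrite !k1E addr0.
  have -> : z s1 + s = z (s1 + (complex.Re s, complex.Im s)) by case: (s).
  apply/hmin/mem_set/sqE; rewrite (le_trans (ler_normD _ _))//.
  rewrite -lerBrDl prod_normE /= ge_max.
  by rewrite !(le_trans _ seta) ?normc_ge_absRe ?normc_ge_absIm.
have /(_ (z (rho, 0) - z s1)) := line_sum_min_modulus eta0 k10 k1min.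
rewrite !k1E addr0 addrC subrK => kconst.
by have := yK _ K0; rewrite /h kconst ltNge ltW.
Qed.

End Amoebas.

(** * Comparison of the supports [T *m B] and [B] *)

Section Caissons.
Variables (R : realType) (d e N : nat) (T : 'M[R]_(d, e)) (B : 'M[R]_(e, N)).
Notation CV := ('rV[R]_N * 'rV[R]_N)%type.
Let A := T *m B.

Lemma inj_col_mulmxr :
  injective (fun j : 'I_N => col j A) -> injective (fun j : 'I_N => col j B).
Proof.
by move=> injA j j' Bjj'; apply: injA; rewrite /A !colE -!mulmxA -!colE Bjj'.
Qed.

(** For fixed [w] the condition on [w'] is closed, and it holds for phases by [torus_cmul_phase]. *)
Lemma torus_cmul (w w' : CV) : torus B w -> torus B w' -> torus B (cmul w w').
Proof.
move=> Tw; apply: (@torus_ind _ _ _ B (cmul w @^-1` torus B)) => [|y].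
  apply: preimage_closed; last exact: closed_closure.
  by move=> v _; apply: continuous_cmul; [exact: cst_continuous|exact: continuous_idfun].
exact: torus_cmul_phase.
Qed.

Lemma torus_mulmx : torus A `<=` torus B.
Proof.
apply: torus_ind => [|y]; first exact: closed_closure.
have -> : phase A y = phase B (y *m T) by rewrite /phase mulmxA.
exact: torus_phase.
Qed.

(** Limits of translates for [B], restricted to the image of [T], become sums with support [A] once
    the factor [w] is absorbed into the coefficients. *)
Lemma twisted_sum_mulmx (c w w' : CV) x :
  twisted_sum A (cmul c w) w' x = twisted_sum B c (cmul w w') (x *m T).
Proof.
by apply: eq_bigr => j _; rewrite !cpx_cmul mulmxA !mulrA.
Qed.

Lemma cmul_phase0 (w : CV) : cmul w (phase A 0) = w.
Proof. by apply: cpx_inj => j; rewrite cpx_cmul phase0 mulr1. Qed.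

Lemma nonvanishing_mulmx (c w : CV) x : torus B w ->
  nonvanishing B c (x *m T) -> nonvanishing A (cmul c w) x.
Proof.
move=> Tw cx w' Tw'; rewrite twisted_sum_mulmx; apply: cx.
by apply: torus_cmul => //; exact: torus_mulmx.
Qed.

Lemma segment_notin_small_caisson (c : 'rV[R[i]]_N) x0 x1 u :
  injective (fun j : 'I_N => col j A) ->
  ~ amoeba (expsum B c) (x0 *m T) -> ~ amoeba (expsum B c) (x1 *m T) ->
  connected_component (~` amoeba (expsum A c)) x0 x1 -> 0 <= u <= 1 ->
  ~ amoeba (expsum B c) ((x0 + u *: (x1 - x0)) *m T).
Proof.
move=> injA Bx0 Bx1 x01 u01.
have injB : injective (fun j : 'I_N => col j B).
  exact: inj_col_mulmxr injA.
have Nx0 := notin_amoeba_nonvanishing injB Bx0.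
have Nx1 := notin_amoeba_nonvanishing injB Bx1.
have torus1 : torus B (phase A 0).
  by apply: torus_mulmx; exact: torus_phase.
have NA x : nonvanishing B (cvec c) (x *m T) -> nonvanishing A (cvec c) x.
  by move=> Nx; rewrite -[cvec c]cmul_phase0; exact: nonvanishing_mulmx.
set E := connected_component _ _ in x01.
have Ex0 : E x0.
  by apply: connected_component_refl; exact/nonvanishing_notin_amoeba/NA.
(* First move: the end point runs through the component, starting from the degenerate segment at
   [x0]. *)
pose S1 := (fun p => (cvec c, p)) @` E.
have cS1 : connected S1.
  apply: connected_continuous_connected; first exact: component_connected.
  by apply: continuous_subspaceT; apply: continuous_pair;
    [exact: cst_continuous|exact: continuous_idfun].
have seg1 : segment_nonvanishing A x0 (cvec c) x1.
  apply: (segment_nonvanishing_connected (q0 := (cvec c, x0)) cS1 _ _ _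
    (q := (cvec c, x1))); [by exists x0|..|by exists x1].
    by move=> t _ /=; rewrite subrr scaler0 addr0; exact: NA.
  move=> _ [p /connected_component_sub Ep <-] /=; split; first exact: NA.
  exact: notin_amoeba_nonvanishing.
(* Second move: the coefficients run through [torus B]; the end points stay good because both lie
   outside the small caisson. *)
pose S2 := (fun w => (cmul (cvec c) w, x1)) @` torus B.
have cS2 : connected S2.
  apply: connected_continuous_connected; first exact: connected_torus.
  apply: continuous_subspaceT; apply: continuous_pair; last exact: cst_continuous.
  by apply: continuous_cmul; [exact: cst_continuous|exact: continuous_idfun].
apply: nonvanishing_notin_amoeba => w Tw.
have /(_ u u01 (phase A 0)) : segment_nonvanishing A x0 (cmul (cvec c) w) x1.
  apply: (segment_nonvanishing_connected (q0 := (cvec c, x1)) cS2 _ seg1 _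
    (q := (cmul (cvec c) w, x1))); [|..|by exists w].
    by exists (phase A 0); rewrite ?cmul_phase0.
  by move=> _ [w' Tw' <-] /=; split; exact: nonvanishing_mulmx.
rewrite twisted_sum_mulmx cmul_phase0; apply; exact: torus_phase.
Qed.

End Caissons.

Theorem theorem4p4 (R : realType) (n m N : nat)
    (A : 'M[R]_(1 + n, N)) (B : 'M[R]_(1 + m, N)) (T : 'M[R]_(1 + n, 1 + m))
    (A_distinct : injective (fun j : 'I_N => col j A))
    (A_homog : pseudo_homogeneous A)
    (B_homog : pseudo_homogeneous B)
    (rowAB : (A <= B)%MS)
    (A_TB : A = T *m B)
    (f : 'rV[R[i]]_(1 + n) -> R[i]) (f_in : exp_space A f) :
  exists F : set 'rV[R]_(1 + n) -> set 'rV[R]_(1 + n),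
    [/\ set_fun (pi0 (~` small_caisson A B T f)) (pi0 (~` amoeba f)) F,
        forall U, pi0 (~` small_caisson A B T f) U -> U `<=` F U &
        set_inj (pi0 (~` small_caisson A B T f)) F].
Proof.
case: f_in => c _ <- {f}.
have scE x : small_caisson A B T (expsum A c) x = amoeba (expsum B c) (x *m T).
  by rewrite /small_caisson /large_caisson Phi_expsum.
set X := ~` small_caisson A B T (expsum A c); set Y := ~` amoeba (expsum A c).
subst A.
have injB : injective (fun j : 'I_N => col j B).
  exact: inj_col_mulmxr A_distinct.
(* The amoeba lies in the small caisson because limits of phases for [T *m B] are limits of phases
   for [B]. *)
have XY : X `<=` Y.
  move=> x; rewrite /X /= scE => /(notin_amoeba_nonvanishing injB) Nx.
  apply: nonvanishing_notin_amoeba; rewrite -[cvec c](cmul_phase0 T B).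
  by apply: nonvanishing_mulmx => //; apply/torus_mulmx; exact: torus_phase.
(* Taking the union over all points of [U] avoids choosing a representative; by [FE] it is a single
   component. *)
pose F (U : set 'rV[R]_(1 + n)) := [set z | exists2 x, U x & connected_component Y x z].
have FE x : X x -> F (connected_component X x) = connected_component Y x.
  move=> Xx; apply/seteqP; split => [z [x' Xxx' Yx'z]|z Yxz]; last first.
    by exists x => //; exact: connected_component_refl.
  apply: connected_component_trans Yx'z.
  case: Xxx' => C [Cx CX cC] Cx'; exists C => //; split => //.
  exact: subset_trans CX XY.
exists F; split.
- by move=> _ [x Xx <-]; rewrite /= FE //; exists x => //; exact: XY.
- move=> _ [x Xx <-] z Xxz; exists z => //; apply/connected_component_refl/XY.
  exact: connected_component_sub Xxz.
move=> _ _ /set_mem[x Xx <-] /set_mem[x' Xx' <-]; rewrite !FE // => E.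
apply: same_connected_component.
have Yxx' : connected_component Y x x'.
  by rewrite E; apply/connected_component_refl/XY.
(* Points of [X] in the same component of [Y] are joined within [X] by a straight segment. *)
pose C := (fun u : R => x + u *: (x' - x)) @` `[0, 1]%classic.
apply: (@connected_component_max _ _ C x).
- by exists 0; rewrite ?scale0r ?addr0//= in_itv /= lexx ler01.
- move=> _ [u u01 <-]; rewrite /X /= scE; move: u01; rewrite /= in_itv /= => u01.
  by apply: segment_notin_small_caisson => //; rewrite -scE.
- apply: connected_continuous_connected; first exact: segment_connected.
  by apply: continuous_subspaceT; apply: continuous_line;
    [exact: cst_continuous|exact: continuous_idfun|exact: cst_continuous].
- by exists 1; rewrite ?scale1r ?(addrC x) ?subrK//= in_itv /= lexx ler01.
Qed.
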